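(* Let $\mathbb{H}$ be a complex Hilbert space, let $K$ be a finite set, and for each $k\in K$ let $\rho\mapsto p_k(\rho)$ be a function assigning to each density operator $\rho$ on $\mathbb{H}$ a real number $p_k(\rho)\ge 0$ (the rate with which detector element $k$ responds to a stationary source with density operator $\rho$), such that $p_k$ depends linearly on $\rho$ and, for each $k\in K$, $p_k(\rho)>0$ for at least one density operator $\rho$. If the rates are normalized such that $\sum_{k\in K}p_k(\rho)=1$ for all density operators $\rho$ with $\operatorname{Tr}\rho=1$, then there is a unique discrete POVM $(P_k)_{k\in K}$ on $\mathbb{H}$ such that $$p_k(\rho)=\operatorname{Tr}(\rho P_k)\qquad\text{for all } k\in K \text{ and all density operators } \rho.$$
   Context: A density operator on a complex Hilbert space $\mathbb{H}$ is a positive semidefinite Hermitian operator $\rho$ on $\mathbb{H}$ with finite trace (it need not be normalized to trace $1$). That $p_k$ depends linearly on $\rho$ means $p_k(\alpha\rho+\beta\rho')=\alpha p_k(\rho)+\beta p_k(\rho')$ for all density operators $\rho,\rho'$ and all real $\alpha,\beta\ge 0$. A discrete POVM (discrete resolution of the identity) on $\mathbb{H}$ indexed by the finite set $K$ is a family $(P_k)_{k\in K}$ of bounded Hermitian positive semidefinite operators on $\mathbb{H}$ with $\sum_{k\in K}P_k=1$ (the identity operator). The Hilbert space may be finite- or infinite-dimensional. *)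

(* Defs.v *)
From HB Require Import structures.
From mathcomp Require Import all_boot all_order all_algebra.
From mathcomp Require Import sesquilinear complex.
From mathcomp Require Import finmap.
From mathcomp Require Import all_classical all_reals all_analysis.
From mathcomp Require Import showcase.summability.

Set Implicit Arguments.
Unset Strict Implicit.
Unset Printing Implicit Defensive.

Import Order.TTheory GRing.Theory Num.Theory Num.Def.
Import numFieldNormedType.Exports.

Local Open Scope classical_set_scope.
Local Open Scope ring_scope.
Local Open Scope complex_scope.

(* [{dot H for conjC}] is linear in its first argument and conjugate-linear in
   the second one; a matrix element <x|A|y> of the physics literature is
   [inner (A y) x]. *)
HB.mixin Record CompleteNormedModule_isHilbert (R : realType) H
    & CompleteNormedModule R[i] H := {
  inner : {dot H for conjC} ;
  inner_norm : forall x : H, inner x x = `|x| ^+ 2 }.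

#[short(type="hilbertType")]
HB.structure Definition Hilbert (R : realType) :=
  { H of CompleteNormedModule R[i] H & CompleteNormedModule_isHilbert R H }.

#[global] Existing Instance totally_filter.

Section Operators.
Variables (R : realType) (H : hilbertType R).
Implicit Types (A B : H -> H) (E : set H) (t : R[i]).

Definition bounded_operator A :=
  linear A /\ exists M : R, forall x, `|A x| <= M%:C * `|x|.

Definition hermitian_operator A :=
  forall x y, inner (A x) y = inner x (A y).

(* In the order of [R[i]], [0 <= z] says that [z] is real and nonnegative. *)
Definition psd_operator A := forall x, 0 <= inner (A x) x.

Definition orthonormal_set E :=
  forall x y, E x -> E y -> inner x y = (x == y)%:R.

Definition orthonormal_basis E :=
  orthonormal_set E /\
  forall x, (forall e, E e -> inner x e = 0) -> x = 0.

(* [E] may be uncountable, so the sum is the limit of the net of all finite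
   partial sums.  [R[i]^o] gives access to the topology of the field [R[i]]. *)
Definition has_trace A t :=
  forall E, orthonormal_basis E ->
  partial_sum (fun e : E => inner (A (val e)) (val e) : R[i]^o) @ totally
    --> (t : R[i]^o).

Definition is_density A :=
  [/\ bounded_operator A, hermitian_operator A, psd_operator A &
      exists t, has_trace A t].

Record density := Density {
  density_fun :> H -> H ;
  densityP : is_density density_fun }.

Definition povm (K : finType) (P : K -> H -> H) :=
  (forall k, [/\ bounded_operator (P k), hermitian_operator (P k) &
                 psd_operator (P k)]) /\
  forall x, \sum_k P k x = x.

Lemma has_trace_comb A B (a b s t : R[i]) :
  has_trace A s -> has_trace B t ->
  has_trace (fun x => a *: A x + b *: B x) (a * s + b * t).
Proof.
move=> hA hB E oE.
have FF : Filter (@totally E) by exact: filter_filter.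
have /(_ FF FF FF) cAB := cvgD (cvgZl_tmp (k := a) (hA E oE))
                 (cvgZl_tmp (k := b) (hB E oE)).
set f := (X in X @ _ --> _) in cAB; set g := (X in X @ _ --> _).
have -> : g = f; last exact: cAB.
apply/funext => F; transitivity
  (a * partial_sum (fun e : E => inner (A (val e)) (val e)) F +
   b * partial_sum (fun e : E => inner (B (val e)) (val e)) F); last by [].
rewrite /g /partial_sum !mulr_sumr -big_split; apply: eq_bigr => e _.
by rewrite linearDl !linearZl.
Qed.

Lemma density_comb_subproof (a b : {nonneg R}) (rho sigma : density) :
  is_density (fun x => a%:num%:C *: rho x + b%:num%:C *: sigma x).
Proof.
have a0 : 0 <= a%:num%:C :> R[i] by rewrite lecR.
have b0 : 0 <= b%:num%:C :> R[i] by rewrite lecR.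
case: rho sigma => A [[lA [M AM]] hA pA [s As]] [B [[lB [N BN]] hB pB [t Bt]]].
split=> /=.
- split=> [c x y|].
    rewrite lA lB !scalerDr !scalerA [c * _]mulrC [c * _ in RHS]mulrC.
    by rewrite addrACA.
  exists (a%:num * M + b%:num * N) => x.
  rewrite (le_trans (ler_normD _ _))// !normrZ !ger0_norm//.
  rewrite rmorphD /= !rmorphM /= mulrDl -!mulrA.
  by rewrite lerD// ler_wpM2l.
- move=> x y; rewrite linearDl linearDr !linearZl !linearZr /= hA hB.
  by rewrite !conj_Creal// ger0_real.
- move=> x; rewrite linearDl !linearZl.
  by apply: addr_ge0; apply: mulr_ge0 => //; [exact: pA|exact: pB].
- by exists (a%:num%:C * s + b%:num%:C * t); exact: has_trace_comb.
Qed.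

Definition density_comb (a b : {nonneg R}) (rho sigma : density) : density :=
  Density (density_comb_subproof a b rho sigma).

(* The quantifier over bases in [has_trace] is not vacuous. *)
Lemma orthonormal_basis_exists : exists E, orthonormal_basis E.
Proof.
have chainU (F : set (set H)) : F `<=` orthonormal_set ->
    total_on F subset -> orthonormal_set (\bigcup_(X in F) X).
  move=> oF totF x y [X FX Xx] [Y FY Yy].
  have [XY|YX] := totF _ _ FX FY; first by apply: (oF _ FY) => //; exact: XY.
  by apply: (oF _ FX) => //; exact: YX.
have [E [oE maxE]] := Zorn_bigcup chainU.
exists E; split=> // x xE; apply: contrapT => /eqP x0.
have nx0 : `|x| != 0 by rewrite normr_eq0.
pose u := `|x|^-1 *: x.
have uE e : E e -> inner u e = 0 
  by move=> /xE xe0; rewrite /u linearZl /= xe0 mulr0.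
have uu : inner u u = 1.
  rewrite /u linearZl linearZr /= inner_norm conj_Creal ?ger0_real ?invr_ge0//.
  by rewrite expr2 mulKf// mulVf.
have Eu : ~ E u.
  by move=> /[dup] /uE; rewrite uu => /eqP; rewrite oner_eq0.
have Eune e : E e -> (u == e) = false.
  by move=> Ee; apply/eqP => ue; apply: Eu; rewrite ue.
apply: (maxE (E `|` [set u])).
  by split=> [|h]; [exact: subsetUl|apply: Eu; apply: h; right].
move=> y z [Ey|->] [Ez|->]; first exact: oE.
- by rewrite hermC /= uE// expr0 mul1r rmorph0 eq_sym Eune.
- by rewrite uE// Eune.
- by rewrite uu eqxx.
Qed.

End Operators.

(* Main.v *)
(** The rates [q v := p_k (|v><v|)] of the rank-one densities satisfy
    [0 <= q v <= |v|^2] and, since [|v><v|] is quadratic in [v] and [p_k] is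
    linear, they form a bounded quadratic form; polarising it and applying the
    Riesz representation theorem gives the operator [P_k] with
    [<P_k v, v> = q v], which also determines [P_k].

    For a general density [rho] and a finite subset [F] of an orthonormal basis,
    eliminating the vectors of [F] one after the other (Cholesky factorisation)
    gives [rho = \sum_v |v><v| + tau] with [tau >= 0] vanishing on [F]; this
    replaces the spectral theorem.  With [Q] the projection on the span of [F]
    and [d := Tr rho - \sum_(e in F) <rho e, e>], the partial trace of
    [rho P_k] over [F] is [\sum_v <Q v, P_k v>], hence differs from
    [p_k rho = \sum_v <v, P_k v> + p_k tau] by at most
    [(Tr rho * \sum_v |v - Q v|^2)^(1/2) + Tr tau], where both
    [\sum_v |v - Q v|^2] and [Tr tau] are at most [d], which tends to 0. *)

Require Import Defs.
From mathcomp Require Import all_boot all_order all_algebra.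
From mathcomp Require Import sesquilinear complex finmap.
From mathcomp Require Import ring lra.
From mathcomp Require Import all_classical all_reals all_analysis.
From mathcomp Require Import showcase.summability.

Set Implicit Arguments.
Unset Strict Implicit.
Unset Printing Implicit Defensive.

Import Order.TTheory GRing.Theory Num.Theory Num.Def.
Import numFieldNormedType.Exports.

Local Open Scope classical_set_scope.
Local Open Scope complex_scope.
Local Open Scope ring_scope.

(** * Limits of finite partial sums, and nonnegative reals inside [R[i]] *)

Section NetSums.
Variable R : realType.

Lemma gt0_complexE (e : R[i]) : 0 < e -> exists2 r : R, 0 < r & e = r%:C.
Proof.
move=> e0; exists (complex.Re e); last by rewrite RRe_real// gtr0_real.
by rewrite -ltcR RRe_real// gtr0_real.
Qed.

Lemma ge0_complexE (e : R[i]) : 0 <= e -> exists2 r : R, 0 <= r & e = r%:C.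
Proof.
move=> e0; exists (complex.Re e); last by rewrite RRe_real// ger0_real.
by rewrite -lecR RRe_real// ger0_real.
Qed.

Lemma partial_sumE (I : choiceType) (V : zmodType) (f : I -> V) F :
  partial_sum f F = \sum_(i <- F) f i.
Proof. by rewrite /partial_sum big_seq_fsetE. Qed.

Lemma totally_cvgP (I : choiceType) (V : normedModType R[i])
    (f : {fset I} -> V) (t : V) :
  f @ totally --> t <->
  forall e : R, 0 < e -> exists F0, forall F, (F0 `<=` F)%fset ->
    `|t - f F| < e%:C.
Proof.
have FF : Filter (@totally I) by exact: filter_filter.
split=> [/cvgrPdist_lt ft e e0|h].
  have /ft[F0 _ h] : 0 < e%:C by rewrite ltcR.
  by exists F0.
apply/cvgrPdist_lt => _ /gt0_complexE[e e0 ->].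
by have [F0 h0] := h _ e0; exists F0.
Qed.

Lemma totally_cvg_unique (I : choiceType) (V : normedModType R[i])
    (f : {fset I} -> V) (s t : V) :
  f @ totally --> s -> f @ totally --> t -> s = t.
Proof. by apply: cvg_unique; exact: norm_hausdorff. Qed.

End NetSums.

(** * Scalar estimates and Cauchy-Schwarz for semidefinite forms *)

Lemma normc_real (R : rcfType) (r : R) : `|r%:C| = `|r|%:C.
Proof. by rewrite normc_def/= expr0n addr0 sqrtr_sqr. Qed.

Lemma eps_eq0 (R : realType) (K : R) (z : R[i]) :
  (forall e : R, 0 < e -> `|z| <= (K * e)%:C) -> z = 0.
Proof.
move=> h; apply/eqP; rewrite -normr_eq0; apply/eqP.
have [r r0 rE] := ge0_complexE (normr_ge0 z); rewrite rE.
suff -> : r = 0 by [].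
apply/eqP; rewrite eq_le r0 andbT leNgt; apply/negP => r_gt0.
have K_gt0 : 0 < K.
  rewrite ltNge; apply/negP => K_le0.
  have := h 1 ltr01; rewrite rE lecR; lra.
have := h (r / (2 * K)); rewrite rE lecR divr_gt0 ?mulr_gt0// => /(_ isT).
have -> : K * (r / (2 * K)) = r / 2 by field; rewrite gt_eqF.
lra.
Qed.

Lemma half_complex (R : rcfType) (r : R) : (r / 2)%:C = r%:C / 2.
Proof. by rewrite rmorphM fmorphV (rmorph_nat (real_complex R)). Qed.

(** Summed over finitely many terms with a common free weight [s], this stands in for Cauchy-Schwarz
    for sums and avoids square roots. *)
Lemma AMGM_weighted (R : realType) (s : R) (a b : R[i]) : 0 < s -> 0 <= a -> 0 <= b ->
  a * b <= (s%:C * a ^+ 2 + s^-1%:C * b ^+ 2) / 2.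
Proof.
move=> s0 /ge0_complexE[x x0 ->] /ge0_complexE[y y0 ->].
have -> : (s%:C * x%:C ^+ 2 + (s^-1)%:C * y%:C ^+ 2) / 2 =
    ((s * x ^+ 2 + s^-1 * y ^+ 2) / 2)%:C.
  by rewrite half_complex !(rmorphD, rmorphM, rmorphXn).
rewrite -rmorphM lecR -subr_ge0.
have -> : (s * x ^+ 2 + s^-1 * y ^+ 2) / 2 - x * y = (s * x - y) ^+ 2 / (2 * s).
  by field; rewrite gt_eqF.
by rewrite divr_ge0 ?sqr_ge0 ?mulr_ge0// ltW.
Qed.

Section CauchySchwarz.
Variables (R : realType) (V : lmodType R[i]) (B : V -> V -> R[i]).
Hypotheses (Blin : forall c x y z, B (c *: x + y) z = c * B x z + B y z)
  (Bherm : forall x y, B y x = (B x y)^*) (Bpos : forall x, 0 <= B x x).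

(** Positivity of [B] at [x - s B(x,y) y] is a quadratic inequality in the real number [s]. As [B]
    may be degenerate, the minimiser [s = 1 / B(y,y)] serves only when [B(y,y) > 0]. *)
Lemma CauchySchwarz_psd x y : `|B x y| ^+ 2 <= B x x * B y y.
Proof.
have Blinr c z u v : B z (c *: u + v) = c^* * B z u + B z v.
  by rewrite Bherm Blin rmorphD rmorphM/= -!Bherm.
have BD t : B (t *: y + x) (t *: y + x) =
    `|t| ^+ 2 * B y y + t * (B x y)^* + (t^* * B x y + B x x).
  by rewrite Blin !Blinr (Bherm x y) normCK mulrDr !mulrA.
have [a a0 aE] := ge0_complexE (Bpos x); have [b b0 bE] := ge0_complexE (Bpos y).
have [n n0 nE] : exists2 n : R, 0 <= n & `|B x y| ^+ 2 = n%:C.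
  by apply: ge0_complexE; rewrite exprn_ge0.
have nC : B x y * (B x y)^* = n%:C by rewrite -normCK.
have key (s : R) : 0 <= s ^+ 2 * n * b - 2 * s * n + a.
  have sR : (- s%:C)^* = - s%:C by rewrite conj_Creal// rpredN complex_real.
  have := Bpos ((- s%:C * B x y) *: y + x); rewrite BD rmorphM/= sR.
  rewrite normrM exprMn nE normrN -[_ * B x y * _]mulrA nC -[_ * B x y]mulrA
    [_^* * _]mulrC nC aE bE.
  rewrite -normrX ger0_norm; last by rewrite -rmorphXn/= lecR sqr_ge0.
  rewrite -rmorphN -rmorphXn -!rmorphM -!rmorphD /= lecR.
  by move=> h; rewrite (le_trans h)// le_eqVlt; apply/orP; left; apply/eqP; ring.
rewrite nE aE bE -rmorphM lecR.
have [b_gt0|] := ltP 0 b.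
  have := key b^-1.
  have -> : b^-1 ^+ 2 * n * b - 2 * b^-1 * n + a = a - n / b.
    by field; rewrite gt_eqF.
  by rewrite subr_ge0 ler_pdivrMr.
move=> b_le0; have {}b0 : b = 0 by apply/eqP; rewrite eq_le b_le0.
rewrite b0 mulr0 leNgt; apply/negP => n_gt0.
(* With [b = 0] the inequality is affine in [s], and this [s] would give [0 <= - a - 2]. *)
have := key (n^-1 * (a + 1)).
rewrite b0 mulr0 add0r -!mulrA [(a + 1) * n]mulrC mulKf ?gt_eqF//; lra.
Qed.

End CauchySchwarz.

(** * Inner products, orthonormal sums and the Riesz-Fischer theorem *)

Section InnerProduct.
Variables (R : realType) (H : hilbertType R).
Implicit Types (x y z : H) (E : set H).

Lemma innerC x y : inner x y = (inner y x)^*.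
Proof. by rewrite hermC expr0 mul1r. Qed.

Lemma innerD x y z : inner (x + y) z = inner x z + inner y z.
Proof. exact: linearDl. Qed.

Lemma innerDr x y z : inner x (y + z) = inner x y + inner x z.
Proof. exact: linearDr. Qed.

Lemma innerB x y z : inner (x - y) z = inner x z - inner y z.
Proof. exact: linearBl. Qed.

Lemma innerBr x y z : inner x (y - z) = inner x y - inner x z.
Proof. exact: linearBr. Qed.

Lemma inner0 x : inner 0 x = 0.
Proof. exact: linear0l. Qed.

Lemma innerZ a x y : inner (a *: x) y = a * inner x y.
Proof. exact: linearZl. Qed.

Lemma innerZr a x y : inner x (a *: y) = a^* * inner x y.
Proof. exact: linearZr. Qed.

Lemma inner_suml (I : Type) (r : seq I) (f : I -> H) y :
  inner (\sum_(i <- r) f i) y = \sum_(i <- r) inner (f i) y.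
Proof.
by elim/big_rec2: _ => [|i a b _ <-]; rewrite (inner0, innerD).
Qed.

Lemma inner_sumr (I : Type) (r : seq I) (f : I -> H) y :
  inner y (\sum_(i <- r) f i) = \sum_(i <- r) inner y (f i).
Proof.
rewrite innerC inner_suml rmorph_sum.
by apply: eq_bigr => i _ /=; rewrite -innerC.
Qed.

Lemma inner_ge0 x : 0 <= inner x x.
Proof. by rewrite inner_norm exprn_ge0. Qed.

Lemma inner_eq0 x : inner x x = 0 -> x = 0.
Proof. by rewrite inner_norm => /eqP; rewrite expf_eq0 normr_eq0 => /eqP. Qed.

Lemma CauchySchwarz_inner x y : `|inner x y| <= `|x| * `|y|.
Proof.
rewrite -ler_sqr ?nnegrE ?mulr_ge0// exprMn -!inner_norm.
apply: (CauchySchwarz_psd (B := fun x y => inner x y)).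
- by move=> c u v w; rewrite innerD innerZ.
- by move=> u v; exact: innerC.
- exact: inner_ge0.
Qed.

Lemma inner_inj x y : (forall z, inner x z = inner y z) -> x = y.
Proof.
move=> h; apply/eqP; rewrite -subr_eq0; apply/eqP/inner_eq0.
by rewrite innerB h subrr.
Qed.

Lemma orthonormal_sum E (F : {fset E}) (c : E -> R[i]) e :
  orthonormal_set E ->
  inner (\sum_(i <- F) c i *: val i) (val e) = if e \in F then c e else 0.
Proof.
move=> oE; rewrite inner_suml.
have cE i : inner (c i *: val i) (val e) = if i == e then c i else 0.
  rewrite innerZ oE; [|exact: set_valP..].
  by rewrite (inj_eq val_inj); case: eqP => _; rewrite (mulr1, mulr0).
under eq_bigr do rewrite cE.
case: ifPn => eF.
  rewrite (big_fsetD1 e)//= eqxx big_seq big1 ?addr0// => i.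
  by rewrite !inE => /andP[/negPf ->].
by rewrite big_seq big1// => i iF; case: eqP iF eF => // -> ->.
Qed.

Lemma orthonormal_sumP E (F : {fset E}) (c : E -> R[i]) :
  orthonormal_set E ->
  `|\sum_(i <- F) c i *: val i| ^+ 2 = \sum_(i <- F) `|c i| ^+ 2.
Proof.
move=> oE; rewrite -inner_norm inner_sumr [LHS]big_seq [RHS]big_seq.
apply: eq_bigr => i iF; rewrite innerZr orthonormal_sum// iF mulrC.
by rewrite normCK.
Qed.

Lemma fset_sumD (I : choiceType) (V : zmodType) (F G : {fset I}) (f : I -> V) :
  (F `<=` G)%fset ->
  \sum_(i <- G) f i = \sum_(i <- F) f i + \sum_(i <- (G `\` F)%fset) f i.
Proof.
move=> FG; rewrite (big_fsetID _ (mem F))/=; congr (_ + _); apply: eq_fbigl => i.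
  by rewrite !inE/= andbC; apply: andb_idr; exact: (fsubsetP FG).
by rewrite !inE/= andbC.
Qed.

(* Square-summable coefficients make the net of finite sums Cauchy: past a
   finite set that nearly reaches the supremum of the sums of squares, the
   squared increments are small. *)
Lemma Riesz_Fischer E (c : E -> R[i]) (M : R) : orthonormal_set E ->
  (forall F : {fset E}, \sum_(i <- F) `|c i| ^+ 2 <= M%:C) ->
  exists2 y, (forall e, inner y (val e) = c e) &
    partial_sum (fun e => c e *: val e) @ totally --> y.
Proof.
move=> oE cM.
pose g (F : {fset E}) := complex.Re (\sum_(i <- F) `|c i| ^+ 2).
have gE (F : {fset E}) : \sum_(i <- F) `|c i| ^+ 2 = (g F)%:C.
  by rewrite RRe_real// ger0_real// sumr_ge0// => i _; rewrite exprn_ge0.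
have gU : has_sup (range g).
  split; first by exists (g fset0); exists fset0.
  by exists M => _ [F _ <-]; rewrite -lecR -gE.
set s := partial_sum _.
have FF : ProperFilter (s @ totally) by exact: fmap_proper_filter.
have : cvg (s @ totally).
  apply: cauchy_cvg; apply: cauchy_exP => _ /gt0_complexE[e e0 ->].
  have [_ [F _ <-] gF] := sup_adherent (exprn_gt0 2 e0) gU.
  exists (s F); exists F => // G /= FG.
  rewrite -ball_normE /= -ltr_sqr ?nnegrE ?lecR ?(ltW e0)//.
  rewrite /s !partial_sumE (fset_sumD _ FG) opprD addNKr normrN.
  rewrite orthonormal_sumP// gE -rmorphXn ltcR.
  have : g G <= sup (range g) by apply: ub_le_sup; [case: gU|exists G].
  have : g G = g F + g (G `\` F)%fset.
    by apply: complexI; rewrite rmorphD/= -!gE (fset_sumD _ FG).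
  by move=> ->; lra.
move=> /cvg_ex[/= y sy]; exists y => // e.
apply/eqP; rewrite -subr_eq0; apply/eqP/(@eps_eq0 _ 1) => r r0.
have [F0 hF] := (totally_cvgP s y).1 sy _ r0.
(* Once [e] is adjoined to [F0], the partial sum has inner product exactly [c e] with [e]. *)
have := hF (e |` F0)%fset (fsubsetU1 _ _).
set F := (_ |` _)%fset; have eF : e \in F by rewrite !inE eqxx.
rewrite /s partial_sumE => h.
have -> : inner y (val e) - c e =
    inner (y - \sum_(i <- F) c i *: val i) (val e).
  by rewrite innerB orthonormal_sum// eF.
rewrite (le_trans (CauchySchwarz_inner _ _))//.
suff -> : `|val e| = 1 by rewrite mulr1 mul1r ltW.
apply/eqP; rewrite -sqrp_eq1// -inner_norm oE ?eqxx//; exact: set_valP.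
Qed.

End InnerProduct.

(** * Basis expansion, Parseval and the Riesz representation theorem *)

Section Basis.
Variables (R : realType) (H : hilbertType R).
Implicit Types (x y z : H) (E : set H).

Lemma Bessel_eq E (F : {fset E}) x : orthonormal_set E ->
  `|x - \sum_(e <- F) inner x (val e) *: val e| ^+ 2 =
  inner x x - \sum_(e <- F) `|inner x (val e)| ^+ 2.
Proof.
move=> oE; set q := \sum_(e <- F) _.
have qq : inner q q = \sum_(e <- F) `|inner x (val e)| ^+ 2.
  by rewrite inner_norm orthonormal_sumP.
have xq : inner x q = inner q q.
  rewrite qq inner_sumr; apply: eq_bigr => e _.
  by rewrite innerZr mulrC normCK.
have qx : inner q x = inner q q by rewrite innerC xq -innerC.
by rewrite -inner_norm dnormB -innerC xq qx -qq; ring.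
Qed.

(** Riesz-Fischer sums the Fourier series of [x] to some [y] with the same coefficients; [x - y] is
    orthogonal to the basis, hence zero. *)
Lemma basis_expansion E x : orthonormal_basis E ->
  partial_sum (fun e : E => inner x (val e) *: val e) @ totally --> x.
Proof.
move=> [oE maxE].
have [r r0 rE] := ge0_complexE (inner_ge0 x).
have [|y ye ycvg] := @Riesz_Fischer _ _ E (fun e => inner x (val e)) r oE.
  by move=> F; rewrite -rE -subr_ge0 -Bessel_eq// exprn_ge0.
suff {2}-> : x = y by exact: ycvg.
apply/eqP; rewrite -subr_eq0; apply/eqP/maxE => e Ee.
by rewrite innerB (ye (SigSub (mem_set Ee))) subrr.
Qed.

Lemma Parseval E x y : orthonormal_basis E ->
  partial_sum (fun e : E => inner x (val e) * inner (val e) y : R[i]^o)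
    @ totally --> (inner x y : R[i]^o).
Proof.
move=> oE; apply/(@totally_cvgP _ _ R[i]^o) => e e0.
have [r r0 rE] := ge0_complexE (normr_ge0 y).
have r1 : 0 < r + 1 by lra.
have [F0 h] := (totally_cvgP _ _).1 (@basis_expansion _ x oE) _ (divr_gt0 e0 r1).
exists F0 => F /h; rewrite !partial_sumE => {}h.
have -> : inner x y - \sum_(i <- F) inner x (val i) * inner (val i) y =
    inner (x - \sum_(i <- F) inner x (val i) *: val i) y.
  by rewrite innerB inner_suml; under [in RHS]eq_bigr do rewrite innerZ.
apply: (le_lt_trans (CauchySchwarz_inner _ _)); rewrite rE.
apply: (@le_lt_trans _ _ ((e / (r + 1))%:C * r%:C)).
  by rewrite ler_wpM2r ?lecR// ltW.
rewrite -rmorphM ltcR mulrAC ltr_pdivrMr//; nra.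
Qed.

(** The candidate has coefficients [(f e)^*] in a basis. Testing the bound on [f] at finite sums
    with these coefficients gives square-summability; the expansion of [x] and continuity then carry
    the identity from the basis to [x]. *)
Lemma Riesz_representation (f : H -> R[i]) (M : R) :
  (forall c x y, f (c *: x + y) = c * f x + f y) ->
  (forall x, `|f x| <= M%:C * `|x|) ->
  exists y, forall x, f x = inner x y.
Proof.
move=> flin fM; have [E oE] := orthonormal_basis_exists H.
have f0 : f 0 = 0.
  have := flin 1 0 0; rewrite scale1r add0r mul1r => /eqP.
  by rewrite -subr_eq subrr => /eqP.
have fsum (F : {fset E}) (c : E -> R[i]) :
    f (\sum_(e <- F) c e *: val e) = \sum_(e <- F) c e * f (val e).
  by elim/big_rec2: _ => [//|e a b _ <-]; rewrite flin.
have [||y ye _] := @Riesz_Fischer _ _ E (fun e => (f (val e))^*) (M ^+ 2).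
- by case: oE.
- move=> F; have [s s0 sE] : exists2 s : R, 0 <= s &
      \sum_(i <- F) `|(f (val i))^*| ^+ 2 = s%:C.
    by apply: ge0_complexE; rewrite sumr_ge0// => i _; rewrite exprn_ge0.
  have := fM (\sum_(i <- F) (f (val i))^* *: val i).
  (* The value of [f] here is [s], the square of the norm [n] of its argument, so the bound reads
     [n ^ 2 <= M n]. *)
  have -> : f (\sum_(i <- F) (f (val i))^* *: val i) = s%:C.
    rewrite fsum -sE; apply: eq_bigr => i _.
    by rewrite norm_conjC normCK mulrC.
  have [n n0 nE] := ge0_complexE (normr_ge0 (\sum_(i <- F) (f (val i))^* *: val i)).
  have := orthonormal_sumP F (fun e => (f (val e))^*) oE.1.
  rewrite sE nE -rmorphXn => /complexI nsE.
  rewrite normc_real -rmorphM !lecR -nsE ger0_norm ?sqr_ge0//.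
  have [->|n_neq0] := eqVneq n 0; first by rewrite expr0n/= sqr_ge0.
  rewrite expr2 ler_pM2r ?lt_neqAle ?n0 ?andbT 1?eq_sym// => nM.
  by rewrite -expr2 ler_sqr ?nnegrE//; lra.
exists y => x; apply/eqP; rewrite -subr_eq0; apply/eqP.
have [r r0 rE] := ge0_complexE (normr_ge0 y).
apply: (@eps_eq0 _ (`|M| + r)) => e e0.
have [F0 h] := (totally_cvgP _ _).1 (@basis_expansion _ x oE) _ e0.
have := h F0 (fsubset_refl _); rewrite partial_sumE => {}h.
set q := \sum_(i <- F0) _ in h.
have qE : f q = inner q y.
  rewrite fsum inner_suml; apply: eq_bigr => i _.
  by rewrite innerZ [inner (val i) y]innerC ye conjCK.
have fE : f x = f (x - q) + f q.
  by rewrite -{1}[x](subrK q) -[x - q in LHS]scale1r flin mul1r.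
have -> : f x - inner x y = f (x - q) - inner (x - q) y.
  by rewrite fE innerB qE; ring.
rewrite (le_trans (ler_normB _ _))// mulrDl rmorphD/= lerD//.
  rewrite (le_trans (fM _))// rmorphM/=.
  apply: (@le_trans _ _ (`|M|%:C * `|x - q|)).
    by rewrite ler_wpM2r// lecR ler_norm.
  by rewrite ler_wpM2l ?lecR// ltW.
rewrite (le_trans (CauchySchwarz_inner _ _))// rE mulrC rmorphM/=.
by rewrite ler_wpM2l ?lecR// ltW.
Qed.

End Basis.

(** * Traces of positive and of rank-one operators *)

Section Trace.
Variables (R : realType) (H : hilbertType R).
Implicit Types (x y z : H) (E : set H).

Lemma has_trace_unique (A : H -> H) s t : has_trace A s -> has_trace A t -> s = t.
Proof.
have [E oE] := orthonormal_basis_exists H.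
by move=> /(_ E oE) + /(_ E oE); exact: (@totally_cvg_unique _ _ R[i]^o).
Qed.

(** Partial sums of nonnegative terms grow with the finite set, so none exceeds the limit, once the
    limit is known to be real. *)
Lemma has_trace_psd_ge (A : H -> H) t E (F : {fset E}) : psd_operator A ->
  has_trace A t -> orthonormal_basis E ->
  \sum_(e <- F) inner (A (val e)) (val e) <= t.
Proof.
move=> A0 At oE.
have AR (G : {fset E}) : exists2 s : R, 0 <= s &
    \sum_(e <- G) inner (A (val e)) (val e) = s%:C.
  by apply: ge0_complexE; rewrite sumr_ge0.
have tcvg := (totally_cvgP _ _).1 (At E oE).
have [T tE] : exists T, t = T%:C.
  apply/complex_realP; apply/CrealP/eqP; rewrite -subr_eq0; apply/eqP.
  apply: (@eps_eq0 _ 2) => e /tcvg[F0 /(_ _ (fsubset_refl _))].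
  rewrite partial_sumE; have [s s0 ->] := AR F0 => h.
  have -> : t^* - t = (t - s%:C)^* - (t - s%:C).
    by rewrite rmorphB/= [s%:C^*]conj_Creal ?complex_real//; ring.
  rewrite (le_trans (ler_normB _ _))// norm_conjC -mulr2n.
  by rewrite mulr_natl rmorphMn/= lerMn2r ltW.
have [s s0 sE] := AR F; rewrite sE tE lecR leNgt; apply/negP => Ts.
have : 0 < s - T by lra.
move=> /tcvg[F0 /(_ _ (fsubsetUl F0 F))]; rewrite partial_sumE.
have [u u0 uE] := AR (F0 `|` F)%fset; rewrite tE uE -rmorphB normc_real ltcR.
have : s <= u.
  rewrite -lecR -uE -sE (fset_sumD _ (fsubsetUr F0 F)) lerDl.
  by rewrite sumr_ge0.
by move=> su; rewrite ltr_norml => /andP[]; lra.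
Qed.

Lemma has_trace_psd_real (A : H -> H) t : psd_operator A -> has_trace A t ->
  exists2 T : R, 0 <= T & t = T%:C.
Proof.
move=> A0 At; have [E oE] := orthonormal_basis_exists H.
apply: ge0_complexE.
by have := has_trace_psd_ge fset0 A0 At oE; rewrite big_seq_fset0.
Qed.

(** In every basis the diagonal sum is the Parseval sum of [inner x y]. *)
Lemma has_trace_rank_one x y : has_trace (fun z => inner z y *: x) (inner x y).
Proof.
move=> E oE; set f := fun e : E => _.
have -> : f = fun e => inner x (val e) * inner (val e) y.
  by apply/funext => e; rewrite /f innerZ mulrC.
exact: Parseval.
Qed.

End Trace.

(** * Density operators and their Cholesky factorisation *)

Section Densities.
Variables (R : realType) (H : hilbertType R).
Implicit Types (x y z v : H) (E : set H) (rho tau : density H).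

(** Rates take records as arguments, so an operator identity must become an equality of records
    before a rate can be applied to it. *)
Lemma density_eq rho tau : rho =1 tau -> rho = tau.
Proof.
case: rho tau => [A pA] [B pB] /= /funext AB; rewrite {}AB in pA *.
by congr Density; exact: Prop_irrelevance.
Qed.

Definition rank_one v : H -> H := fun x => inner x v *: v.

Lemma rank_one_is_density v : is_density (rank_one v).
Proof.
rewrite /rank_one; split.
- split=> [c x y|]; first by rewrite innerD innerZ scalerDl scalerA.
  have [r r0 rE] := ge0_complexE (normr_ge0 v).
  exists (r ^+ 2) => x; rewrite normrZ rmorphXn/= -rE expr2 mulrAC.
  by rewrite ler_wpM2r// mulrC CauchySchwarz_inner.
- by move=> x y; rewrite innerZ innerZr -innerC mulrC.
- by move=> x; rewrite innerZ [inner v x]innerC -normCK exprn_ge0.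
- by exists (inner v v); exact: has_trace_rank_one.
Qed.

Definition rank_one_density v := Density (rank_one_is_density v).

Lemma density_linear rho c x y : rho (c *: x + y) = c *: rho x + rho y.
Proof. by case: rho => A [[lA _] _ _ _] /=; exact: lA. Qed.

Lemma density_hermitian rho x y : inner (rho x) y = inner x (rho y).
Proof. by case: rho => A [_ hA _ _] /=; exact: hA. Qed.

Lemma density_psd rho : psd_operator rho.
Proof. by case: rho => A []. Qed.

Lemma density_CauchySchwarz rho x y :
  `|inner (rho x) y| ^+ 2 <= inner (rho x) x * inner (rho y) y.
Proof.
apply: (CauchySchwarz_psd (B := fun x y => inner (rho x) y)).
- by move=> c u v w; rewrite density_linear innerD innerZ.
- by move=> u v; rewrite density_hermitian innerC.
- exact: density_psd.
Qed.

Lemma density_eq0 rho x : inner (rho x) x = 0 -> rho x = 0.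
Proof.
move=> rx0; apply: inner_eq0.
have := density_CauchySchwarz rho x (rho x); rewrite rx0 mul0r.
move=> h; have : `|inner (rho x) (rho x)| ^+ 2 == 0 by rewrite eq_le h exprn_ge0.
by rewrite expf_eq0 normr_eq0 => /eqP.
Qed.

(* One step of the Cholesky factorisation: the Schur complement of [rho]
   with respect to the vector [e]. *)
Lemma density_pivot rho e : exists v tau,
  [/\ forall x, rho x = rank_one v x + tau x, tau e = 0 &
      forall x, rho x = 0 -> tau x = 0].
Proof.
have [re0|re_neq0] := eqVneq (inner (rho e) e) 0.
  exists 0, rho; split=> //; last exact: density_eq0.
  by move=> x; rewrite /rank_one scaler0 add0r.
have [a a0 aE] := ge0_complexE (density_psd rho e).
have a_gt0 : 0 < a.
  rewrite lt_neqAle a0 andbT eq_sym; apply: contra re_neq0 => /eqP a_eq0.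
  by rewrite aE a_eq0.
(* This is [v = a^(-1/2) rho e], for which [rank_one v] agrees with [rho] at [e]. *)
pose b := Num.sqrt a^-1; pose v := b%:C *: rho e.
have bb : b%:C * b%:C = a^-1%:C.
  by rewrite -rmorphM -expr2 sqr_sqrtr// invr_ge0.
have b_real : b%:C^* = b%:C by rewrite conj_Creal// complex_real.
have vE x : rank_one v x = (a^-1%:C * inner (rho x) e) *: rho e.
  rewrite /rank_one /v innerZr scalerA b_real -density_hermitian.
  by rewrite mulrAC bb.
pose A x := 1 *: rho x + (-1) *: rank_one v x.
have AE x : A x = rho x - rank_one v x by rewrite /A scale1r scaleN1r.
have Ad : is_density A.
  split.
  - split=> [c x y|].
      have [[lv _] _ _ _] := rank_one_is_density v.
      by rewrite !AE density_linear lv opprD scalerBr addrACA.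
    have [_ [M hM]] : bounded_operator rho by case: (densityP rho).
    have [_ [N hN]] : bounded_operator (rank_one v).
      by case: (rank_one_is_density v).
    exists (M + N) => x; rewrite AE rmorphD/= mulrDl.
    by rewrite (le_trans (ler_normB _ _))// lerD.
  - have [_ hv _ _] := rank_one_is_density v.
    by move=> x y; rewrite !AE innerB innerBr hv density_hermitian.
  (* Positivity of the Schur complement is Cauchy-Schwarz for [rho] at [x] and [e]. *)
  - move=> x; rewrite AE innerB subr_ge0 vE innerZ -mulrA.
    rewrite [inner (rho e) x]density_hermitian [inner e _]innerC -normCK.
    apply: (@le_trans _ _ (a^-1%:C * (inner (rho x) x * a%:C))).
      rewrite ler_wpM2l ?lecR ?invr_ge0// -aE.
      exact: density_CauchySchwarz.
    by rewrite mulrCA -rmorphM mulVf ?gt_eqF// mulr1.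
  - have [_ _ _ [t rt]] := densityP rho.
    exists (1 * t + (-1) * inner v v).
    exact: has_trace_comb rt (@has_trace_rank_one _ _ v v).
exists v, (Density Ad); split=> [x||x rx0] /=; rewrite AE vE.
- by rewrite -vE addrC subrK.
- by rewrite aE -rmorphM mulVf ?gt_eqF// scale1r subrr.
- by rewrite rx0 inner0 mulr0 scale0r subrr.
Qed.

(** The last clause of [density_pivot] keeps the vectors already eliminated in the kernel of the
    next remainder. *)
Lemma density_factor rho (l : seq H) : exists vs tau,
  [/\ forall x, rho x = \sum_(v <- vs) rank_one v x + tau x &
      forall e, e \in l -> tau e = 0].
Proof.
elim: l => [|e l [vs [tau [rhoE tau0]]]].
  by exists [::], rho; split=> // x; rewrite big_nil add0r.
have [v [sigma [tauE se0 s0]]] := density_pivot tau e.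
exists (v :: vs), sigma; split=> [x|d].
  by rewrite rhoE tauE big_cons addrCA addrA.
by rewrite inE => /predU1P[->//|/tau0/s0].
Qed.

Lemma has_trace_sum_rank_one (vs : seq H) :
  has_trace (fun x => \sum_(v <- vs) rank_one v x) (\sum_(v <- vs) inner v v).
Proof.
elim: vs => [|v vs IH].
  rewrite big_nil => E oE; apply/(@totally_cvgP _ _ R[i]^o) => e e0.
  exists fset0 => F _; rewrite partial_sumE big1 ?subr0 ?normr0 ?ltcR// => i _.
  by rewrite big_nil inner0.
have := has_trace_comb (a := 1) (b := 1) (@has_trace_rank_one _ _ v v) IH.
rewrite !mul1r big_cons; congr has_trace; apply/funext => x.
by rewrite big_cons !scale1r.
Qed.

Lemma has_trace_factor rho (vs : seq H) tau t :
  (forall x, rho x = \sum_(v <- vs) rank_one v x + tau x) ->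
  has_trace rho t -> has_trace tau (t - \sum_(v <- vs) inner v v).
Proof.
move=> rhoE rt.
have := has_trace_comb (a := 1) (b := -1) rt (@has_trace_sum_rank_one vs).
rewrite mul1r mulN1r; congr has_trace; apply/funext => x.
by rewrite scale1r scaleN1r rhoE addrC addKr.
Qed.

End Densities.

(** * Polarisation of the rank-one rates and the operator they define *)

Section PositiveFunctional.
Variables (R : realType) (H : hilbertType R) (phi : density H -> R).
Hypotheses (phi_ge0 : forall rho, 0 <= phi rho)
  (phi_linear : forall (a b : {nonneg R}) (rho sigma : density H),
    phi (density_comb a b rho sigma) = a%:num * phi rho + b%:num * phi sigma)
  (phi_le_trace : forall (rho : density H) (t : R),
    has_trace rho t%:C -> phi rho <= t).
Implicit Types (x y z v w : H).

Let q v := phi (rank_one_density v).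

Lemma inner_rank_one v x y : inner (rank_one v x) y = inner x v * inner v y.
Proof. exact: innerZ. Qed.

(** Equal matrix elements mean equal densities, so polynomial identities between rank-one operators
    pass to [q]. Weights must be nonnegative, hence differences are moved across the equation. *)
Lemma phi_rank_one2 (r : R) a b c d : 0 <= r ->
  (forall z w, inner z a * inner a w + r%:C * (inner z b * inner b w) =
               inner z c * inner c w + r%:C * (inner z d * inner d w)) ->
  q a + r * q b = q c + r * q d.
Proof.
move=> r0 h.
have := phi_linear 1%:nng (NngNum r0) (rank_one_density a) (rank_one_density b).
have := phi_linear 1%:nng (NngNum r0) (rank_one_density c) (rank_one_density d).
rewrite /= !mul1r => <- <-; congr phi; apply: density_eq => z /=.
apply: inner_inj => w.
by rewrite !innerD ![inner (_%:C *: _) _]innerZ !mul1r !inner_rank_one h.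
Qed.

Lemma phi_rank_one3 a b c d e f :
  (forall z w, inner z a * inner a w + (inner z b * inner b w +
                 inner z c * inner c w) =
               inner z d * inner d w + (inner z e * inner e w +
                 inner z f * inner f w)) ->
  q a + (q b + q c) = q d + (q e + q f).
Proof.
move=> h.
have add rho sigma : phi (density_comb 1%:nng 1%:nng rho sigma) =
    phi rho + phi sigma by rewrite phi_linear !mul1r.
rewrite -!add; congr phi; apply: density_eq => z /=.
apply: inner_inj => w.
by rewrite !scale1r !innerD !inner_rank_one h.
Qed.

Lemma phi_rank_one0 : q 0 = 0.
Proof.
apply/eqP; rewrite eq_le phi_ge0 andbT; apply: phi_le_trace.
have := @has_trace_rank_one _ _ (0 : H) 0; rewrite inner0; exact.
Qed.

Lemma phi_rank_one_unit (c : R[i]) x : c * c^* = 1 -> q (c *: x) = q x.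
Proof.
move=> c1; congr phi; apply: density_eq => z /=.
by rewrite /rank_one innerZr scalerA mulrAC [_^* * _]mulrC c1 mul1r.
Qed.

Lemma phi_rank_oneN x : q (- x) = q x.
Proof.
rewrite -scaleN1r phi_rank_one_unit //.
by rewrite rmorphN rmorph1 mulrNN mulr1.
Qed.

(** The real part of the sesquilinear form to be built. *)
Let S x y := (q (x + y) - q (x - y)) / 4.

Lemma polar_sym x y : S x y = S y x.
Proof. by rewrite /S [x + y]addrC -(phi_rank_oneN (x - y)) opprB. Qed.

Lemma polarN x y : S (- x) y = - S x y.
Proof.
have -> : S (- x) y = (q (x - y) - q (x + y)) / 4; last by rewrite /S; lra.
rewrite /S [- x + y]addrC -(phi_rank_oneN (x - y)) -(phi_rank_oneN (x + y)).
by rewrite opprB opprD.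
Qed.

(** One six-term identity among rank-one operators gives additivity directly, without the halving
    argument of Jordan and von Neumann. *)
Lemma polarD x y z : S (x + y) z = S x z + S y z.
Proof.
have : q (x + y + z) + (q (x - z) + q (y - z)) =
       q (x + y - z) + (q (x + z) + q (y + z)).
  apply: phi_rank_one3 => u w.
  by rewrite !(innerB, innerBr, innerD, innerDr); ring.
rewrite /S; lra.
Qed.

(** Linearity of [phi] over all nonnegative reals gives homogeneity at once; no passage from
    rationals to reals by continuity is involved. *)
Lemma polarZ (r : R) x y : S (r%:C *: x) y = r * S x y.
Proof.
wlog r0 : r / 0 <= r => [h|].
  have [/h//|r0] := leP 0 r.
  have := h (- r); rewrite rmorphN scaleNr polarN; lra.
have rC : r%:C^* = r%:C :> R[i] by rewrite conj_Creal// complex_real.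
have : q (r%:C *: x + y) + r * q (x - y) = q (r%:C *: x - y) + r * q (x + y).
  apply: phi_rank_one2 => // u w.
  rewrite !(innerB, innerBr, innerD, innerDr, innerZ, innerZr) rC; ring.
rewrite /S; lra.
Qed.

Lemma polarii x y : S ('i *: x) ('i *: y) = S x y.
Proof.
have ii : 'i * 'i^* = 1 :> R[i] by rewrite conjCi mulrN -expr2 sqrCi opprK.
by rewrite /S -scalerDr -scalerBr !phi_rank_one_unit.
Qed.

Lemma polarxx x : S x x = q x.
Proof.
have : q (2%:C *: x) + 4 * q 0 = q 0 + 4 * q x.
  apply: phi_rank_one2 => // u w.
  rewrite !innerZ !innerZr inner0 !(rmorph_nat (real_complex R)) rmorph_nat.
  ring.
rewrite /S subrr phi_rank_one0 (rmorph_nat (real_complex R)) scaler_nat mulr2n.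
lra.
Qed.

Lemma polarix x y : S ('i *: x) y = - S x ('i *: y).
Proof.
have ii : 'i *: ('i *: x) = - x by rewrite scalerA -expr2 sqrCi scaleN1r.
by rewrite -polarii ii polarN.
Qed.

(** For a form conjugate-linear in [y], the imaginary part at [(x, y)] is the real part at
    [(x, 'i *: y)]; this dictates the formula. *)
Let B x y := (S x y)%:C + 'i * (S x ('i *: y))%:C.

Lemma form_linear c x y z : B (c *: x + y) z = c * B x z + B y z.
Proof.
have [a aE] := complex_realP _ (Creal_Re c).
have [b bE] := complex_realP _ (Creal_Im c).
have BD u v : B (u + v) z = B u z + B v z.
  by rewrite /B !polarD !rmorphD/=; ring.
have BZ (r : R) u : B (r%:C *: u) z = r%:C * B u z.
  by rewrite /B !polarZ !rmorphM/=; ring.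
have Bi u : B ('i *: u) z = 'i * B u z.
  rewrite /B polarix polarii rmorphN/= mulrDr mulrA -expr2 sqrCi; ring.
rewrite BD [c in LHS]Crect [c in RHS]Crect aE bE.
by rewrite scalerDl BD BZ -scalerA Bi BZ; ring.
Qed.

Lemma form_hermitian x y : B y x = (B x y)^*.
Proof.
rewrite /B rmorphD rmorphM/= conjCi !conj_Creal ?complex_real//.
rewrite [S y x]polar_sym [S y _]polar_sym polarix rmorphN; ring.
Qed.

Lemma form_diag x : B x x = (q x)%:C.
Proof.
suff S0 : S x ('i *: x) = 0 by rewrite /B S0 mulr0 addr0 polarxx.
by have := polarix x x; rewrite polar_sym; lra.
Qed.

Lemma phi_rank_one_le x : (q x)%:C <= `|x| ^+ 2.
Proof.
have [r r0 rE] := ge0_complexE (inner_ge0 x).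
rewrite -inner_norm rE lecR; apply: phi_le_trace; rewrite -rE.
exact: has_trace_rank_one.
Qed.

Lemma form_le x y : `|B x y| <= `|x| * `|y|.
Proof.
rewrite -ler_sqr ?nnegrE ?mulr_ge0// exprMn.
have Bpos z : 0 <= B z z by rewrite form_diag lecR phi_ge0.
rewrite (le_trans (CauchySchwarz_psd form_linear form_hermitian Bpos x y))//.
by rewrite !form_diag ler_pM ?lecR ?phi_ge0 ?phi_rank_one_le.
Qed.

(** Riesz representation of [B ^~ y] defines [P y]; linearity and symmetry of [P] come from those of
    [B]. *)
Lemma form_operator : exists P : H -> H,
  [/\ linear P, forall x, `|P x| <= `|x|, hermitian_operator P &
      forall x, inner (P x) x = (q x)%:C].
Proof.
have : forall y, exists z, forall x, B x y = inner x z.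
  move=> y; have [r r0 rE] := ge0_complexE (normr_ge0 y).
  apply: (@Riesz_representation _ _ (B ^~ y) r) => [c x z|x].
    exact: form_linear.
  by rewrite -rE mulrC form_le.
move=> /boolp.choice[P PE]; exists P.
have PEl x y : inner (P x) y = B x y by rewrite innerC -PE -form_hermitian.
split=> [c x y|x|x y|x].
- by apply: inner_inj => z; rewrite innerD innerZ !PEl form_linear.
(* Here [B x (P x)] is the square of the norm of [P x], and one factor cancels unless [P x = 0]. *)
- have := form_le x (P x); rewrite -PEl inner_norm normrX normr_id expr2.
  have [->|Px0] := eqVneq (P x) 0; first by rewrite normr0.
  by rewrite ler_pM2r ?normr_gt0.
- by rewrite -PE PEl.
- by rewrite PEl form_diag.
Qed.

End PositiveFunctional.

(** * The trace formula for general densities *)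

Section TraceFormula.
Variables (R : realType) (H : hilbertType R) (phi : density H -> R).
Hypotheses (phi_ge0 : forall rho, 0 <= phi rho)
  (phi_linear : forall (a b : {nonneg R}) (rho sigma : density H),
    phi (density_comb a b rho sigma) = a%:num * phi rho + b%:num * phi sigma)
  (phi_le_trace : forall (rho : density H) (t : R),
    has_trace rho t%:C -> phi rho <= t).
Implicit Types (x y v w : H) (E : set H) (rho tau : density H).

Lemma phi_factor rho tau (vs : seq H) :
  (forall x, rho x = \sum_(v <- vs) rank_one v x + tau x) ->
  phi rho = \sum_(v <- vs) phi (rank_one_density v) + phi tau.
Proof.
elim: vs rho => [|v vs IH] rho rhoE.
  rewrite big_nil add0r; congr phi; apply: density_eq => x.
  by rewrite rhoE big_nil add0r.
pose one := NngNum (@ler01 R).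
pose add v sigma := density_comb one one (rank_one_density v) sigma.
(* The tail of the decomposition is rebuilt as a record, to which the induction hypothesis
   applies. *)
pose sigma := foldr add tau vs.
have sigmaE x : sigma x = \sum_(w <- vs) rank_one w x + tau x.
  rewrite /sigma; elim: (vs) => [|w ws IHw] /=; first by rewrite big_nil add0r.
  by rewrite big_cons IHw !scale1r addrA.
rewrite big_cons -addrA -(IH _ sigmaE) (_ : rho = add v sigma).
  by rewrite /add phi_linear !mul1r.
apply: density_eq => x; rewrite rhoE big_cons.
by rewrite [in RHS]/= !scale1r sigmaE addrA.
Qed.

Variable P : H -> H.
Hypotheses (P_le : forall x, `|P x| <= `|x|) (P_herm : hermitian_operator P)
  (P_diag : forall x, inner (P x) x = (phi (rank_one_density x))%:C).

(** The factorisation depends on [F], so the bound involves only the trace [T] and its part [t] over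
    [F]. The free weight [s] replaces the square root of a product. *)
Lemma partial_trace_estimate E (F : {fset E}) rho (T t s : R) :
  orthonormal_set E -> has_trace rho T%:C -> 0 < s ->
  \sum_(e <- F) inner (rho (val e)) (val e) = t%:C ->
  `|(phi rho)%:C - \sum_(e <- F) inner (rho (P (val e))) (val e)| <=
  ((s * (T - t) + s^-1 * T) / 2 + (T - t))%:C.
Proof.
move=> oE rhoT s0 tE.
have [vs [tau [rhoE tau0]]] := density_factor rho [seq val e | e <- F].
have rhoE' e : e \in F -> rho (val e) = \sum_(v <- vs) rank_one v (val e).
  by move=> eF; rewrite rhoE tau0 ?addr0// map_f.
pose Q v := \sum_(e <- F) inner v (val e) *: val e.
have [N N0 NE] : exists2 N : R, 0 <= N & \sum_(v <- vs) inner v v = N%:C.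
  by apply: ge0_complexE; rewrite sumr_ge0// => v _; exact: inner_ge0.
(* By Bessel's equality the defects add up to [N] minus the diagonal of [rho] on [F], where [tau]
   vanishes. *)
have QE : \sum_(v <- vs) `|v - Q v| ^+ 2 = (N - t)%:C.
  under eq_bigr do rewrite Bessel_eq//.
  rewrite sumrB NE rmorphB/=; congr (_ - _).
  rewrite exchange_big/= -tE big_seq [RHS]big_seq; apply: eq_bigr => e eF.
  rewrite rhoE'// inner_suml; apply: eq_bigr => v _.
  by rewrite inner_rank_one [inner (val e) v]innerC mulrC normCK.
have tN : t <= N.
  by rewrite -subr_ge0 -lecR -QE sumr_ge0// => v _; rewrite exprn_ge0.
have tauT : has_trace tau (T - N)%:C.
  by rewrite rmorphB/= -NE; exact: has_trace_factor rhoT.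
have tau_le := phi_le_trace tauT.
have sumE : \sum_(e <- F) inner (rho (P (val e))) (val e) =
    \sum_(v <- vs) inner (Q v) (P v).
  under [RHS]eq_bigr do rewrite inner_suml.
  rewrite exchange_big/= big_seq [RHS]big_seq; apply: eq_bigr => e eF.
  rewrite density_hermitian rhoE'// inner_sumr; apply: eq_bigr => v _.
  by rewrite /rank_one innerZr innerZ -innerC P_herm.
have phiE : (phi rho)%:C - \sum_(e <- F) inner (rho (P (val e))) (val e) =
    \sum_(v <- vs) inner (v - Q v) (P v) + (phi tau)%:C.
  rewrite (phi_factor rhoE) sumE rmorphD/= addrAC; congr (_ + _).
  rewrite rmorph_sum/= -sumrB; apply: eq_bigr => v _.
  by rewrite -P_diag innerB P_herm.
rewrite phiE (le_trans (ler_normD _ _))//.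
apply: (@le_trans _ _ (((s * (N - t) + s^-1 * N) / 2)%:C + (T - N)%:C)).
  rewrite lerD//; last by rewrite normc_real lecR ger0_norm.
  rewrite (le_trans (ler_norm_sum _ _ _))//.
  apply: (@le_trans _ _ (\sum_(v <- vs)
      (s%:C * `|v - Q v| ^+ 2 + s^-1%:C * inner v v) / 2)).
    apply: ler_sum => v _; rewrite (le_trans (CauchySchwarz_inner _ _))//.
    rewrite inner_norm (le_trans _ (AMGM_weighted s0 _ _))//.
    by rewrite ler_wpM2l.
  rewrite -mulr_suml big_split/= -!mulr_sumr QE NE.
  by rewrite -!rmorphM -rmorphD/= half_complex.
rewrite -rmorphD lecR.
(* The inequality [N <= T] follows from [0 <= phi tau <= T - N]. *)
have sN : s^-1 * N <= s^-1 * T.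
  by rewrite ler_wpM2l ?invr_ge0 ?(ltW s0)//; have := phi_ge0 tau; lra.
have : s * (N - t) <= s * (T - t).
  by rewrite ler_wpM2l ?(ltW s0)//; have := phi_ge0 tau; lra.
lra.
Qed.

Lemma form_operator_trace rho : has_trace (rho \o P) (phi rho)%:C.
Proof.
have [t rhot] : exists t, has_trace rho t by case: (densityP rho).
have [T T0 TE] := has_trace_psd_real (density_psd rho) rhot.
rewrite {}TE in rhot.
move=> E oE; apply/(@totally_cvgP _ _ R[i]^o) => e e0.
(* This [s] makes [s^-1 * T < e], and the tolerance [e / (s + 2)] makes [(s + 2) * (T - u) < e]; the
   estimate is half the sum of these two quantities. *)
pose s := (T + 1) / e.
have s0 : 0 < s by rewrite divr_gt0//; lra.
have d0 : 0 < e / (s + 2) by rewrite divr_gt0//; lra.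
have [F0 h] := (@totally_cvgP _ _ R[i]^o _ _).1 (rhot E oE) _ d0.
exists F0 => F /h; rewrite !partial_sumE.
have [u u0 uE] : exists2 u : R, 0 <= u &
    \sum_(e <- F) inner (rho (val e)) (val e) = u%:C.
  by apply: ge0_complexE; rewrite sumr_ge0// => i _; exact: density_psd.
rewrite uE -rmorphB normc_real ltcR => Tu.
apply: (le_lt_trans (partial_trace_estimate oE.1 rhot s0 uE)).
rewrite ltcR.
have {Tu} : (T - u) * (s + 2) < e.
  by rewrite -ltr_pdivlMr; [exact: le_lt_trans (ler_norm _) Tu|lra].
have : s^-1 * T < e.
  by rewrite /s invf_div mulrAC ltr_pdivrMr ?mulrDr ?mulr1 ?ltrDl//; lra.
lra.
Qed.

End TraceFormula.

(** * Uniqueness from diagonals, normalisation at arbitrary trace, and the POVM *)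

Lemma hermitian_operator_ext (R : realType) (H : hilbertType R) (A B : H -> H) :
  linear A -> linear B -> hermitian_operator A -> hermitian_operator B ->
  (forall x, inner (A x) x = inner (B x) x) -> A =1 B.
Proof.
move=> lA lB hA hB AB x.
have [D DE] : exists D, forall u, D u = A u - B u by exists (fun u => A u - B u).
have DD u v : D (u + v) = D u + D v.
  have := lA 1 u v; have := lB 1 u v; rewrite !DE !scale1r => -> ->.
  by rewrite opprD addrACA.
have hD u v : inner (D u) v = inner u (D v) by rewrite !DE innerB innerBr hA hB.
have D0 u : inner (D u) u = 0 by rewrite DE innerB AB subrr.
apply/eqP; rewrite -subr_eq0 -DE; apply/eqP/inner_eq0.
(* The form of [D] vanishes on the diagonal, so at [x + D x] only the two cross terms remain, both
   equal to [inner (D x) (D x)]. *)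
have := D0 (x + D x); rewrite DD innerD !innerDr !D0 add0r addr0 (hD (D x) x).
by rewrite -mulr2n => /eqP; rewrite mulrn_eq0 => /eqP.
Qed.

(** The product is again of rank one, so rank-one densities read off the diagonal of [A] from
    traces. *)
Lemma has_trace_rank_one_comp (R : realType) (H : hilbertType R) (A : H -> H) x :
  hermitian_operator A -> has_trace (rank_one_density x \o A) (inner (A x) x).
Proof.
move=> hA; rewrite hA (_ : _ \o _ = fun y => inner y (A x) *: x).
  exact: has_trace_rank_one.
by apply/funext => y /=; rewrite /rank_one hA.
Qed.

Lemma trace0_density (R : realType) (H : hilbertType R) (rho : density H) :
  has_trace rho 0 -> forall x, rho x = 0.
Proof.
move=> rho0 x; have [E oE] := orthonormal_basis_exists H.
apply: oE.2 => e Ee; rewrite density_hermitian.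
suff -> : rho e = 0 by rewrite innerC inner0 conjC0.
apply/density_eq0/eqP; rewrite eq_le density_psd andbT.
have := has_trace_psd_ge [fset (SigSub (mem_set Ee) : E)]%fset
  (density_psd rho) rho0 oE.
by rewrite big_seq_fset1.
Qed.

(** Rescaling by [t^-1] reduces to trace 1; trace 0 forces [rho] to vanish. *)
Lemma total_rate_trace (R : realType) (H : hilbertType R) (K : finType)
    (p : K -> density H -> R)
    (p_linear : forall k (a b : {nonneg R}) (rho sigma : density H),
      p k (density_comb a b rho sigma) = a%:num * p k rho + b%:num * p k sigma)
    (p_normalized : forall rho : density H,
      has_trace rho 1 -> \sum_(k : K) p k rho = 1) (rho : density H) (t : R) :
  has_trace rho t%:C -> \sum_k p k rho = t.
Proof.
move=> rhot.
have t0 : 0 <= t.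
  have [s s0] := has_trace_psd_real (density_psd rho) rhot.
  by move=> /complexI ->.
pose zero := NngNum (lexx (0 : R)).
have [t_eq0|t_neq0] := eqVneq t 0.
  rewrite t_eq0 in rhot *; rewrite big1// => k _.
  (* The zero density is a combination with both weights 0, so linearity makes its rate 0. *)
  have -> : rho = density_comb zero zero rho rho.
    by apply: density_eq => x /=; rewrite trace0_density// scaler0 addr0.
  by rewrite p_linear !mul0r addr0.
have it0 : 0 <= t^-1 by rewrite invr_ge0.
pose sigma := density_comb (NngNum it0) zero rho rho.
have : has_trace sigma 1.
  have := has_trace_comb (a := t^-1%:C) (b := 0) rhot rhot.
  rewrite mul0r addr0 -rmorphM mulVf//; exact.
move=> /p_normalized; under eq_bigr do rewrite p_linear/= mul0r addr0.
rewrite -mulr_sumr => h.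
by rewrite -[LHS](mulVKf t_neq0) h mulr1.
Qed.

Theorem theorem1p1 (R : realType) (H : hilbertType R) (K : finType)
    (p : K -> density H -> R)
    (p_ge0 : forall k rho, 0 <= p k rho)
    (p_linear : forall k (a b : {nonneg R}) (rho sigma : density H),
      p k (density_comb a b rho sigma) = a%:num * p k rho + b%:num * p k sigma)
    (p_pos : forall k, exists rho, 0 < p k rho)
    (p_normalized : forall rho : density H,
      has_trace rho 1 -> \sum_(k : K) p k rho = 1) :
  exists! P : K -> H -> H,
    povm P /\ forall k (rho : density H), has_trace (rho \o P k) (p k rho)%:C.
Proof.
(* A single rate is at most the total rate, which is the trace. *)
have p_le k (rho : density H) (t : R) : has_trace rho t%:C -> p k rho <= t.
  move=> /(total_rate_trace p_linear p_normalized) <-.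
  by rewrite (bigD1 k)//= lerDl sumr_ge0.
have /boolp.choice[P PE] k := form_operator (p_ge0 k) (p_linear k) (p_le k).
have Ptr k (rho : density H) : has_trace (rho \o P k) (p k rho)%:C.
  have [lP leP hP dP] := PE k.
  exact: (form_operator_trace (p_ge0 k) (p_linear k) (p_le k)).
exists P; split; last first.
  move=> Q [[Q_op _] Qtr]; apply/funext => k; apply/funext.
  have [[lQ _] hQ _] := Q_op k; have [lP _ hP _] := PE k.
  apply: hermitian_operator_ext => // x.
  apply: (has_trace_unique (A := rank_one_density x \o P k)).
    exact: has_trace_rank_one_comp.
  rewrite (has_trace_unique (@has_trace_rank_one_comp _ _ _ x hQ) (Qtr k _)).
  exact: Ptr.
split=> //; split=> [k|].
  have [lP leP hP dP] := PE k; split=> //.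
    by split=> //; exists 1 => x; rewrite mul1r.
  by move=> x; rewrite dP lecR p_ge0.
(* Both sides are Hermitian, and the total rate of [rank_one_density x] shows that their diagonals
   agree. *)
apply: (hermitian_operator_ext (B := id)) => //.
- move=> c x y; rewrite scaler_sumr -big_split; apply: eq_bigr => k _.
  by have [lP _ _ _] := PE k; rewrite lP.
- move=> x y; rewrite inner_suml inner_sumr; apply: eq_bigr => k _.
  by have [_ _ hP _] := PE k; rewrite hP.
- move=> x; rewrite inner_suml.
  have [r r0 rE] := ge0_complexE (inner_ge0 x).
  have pr : \sum_k p k (rank_one_density x) = r.
    apply: (total_rate_trace p_linear p_normalized).
    by rewrite -rE; exact: has_trace_rank_one.
  rewrite rE -pr.
  rewrite rmorph_sum; apply: eq_bigr => k _.
  by have [_ _ _ ->] := PE k.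
Qed.
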